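(* Let $(\mathbf{X}^m(\cdot),\kappa^m(\cdot))$ be the solution of the following full discretization: given $\Gamma^0=\mathbf{X}^0=(x^0,y^0)^T\in\mathbb{X}^h$ with $x_l^0=x^0(0)<x_r^0=x^0(1)$, for $m\ge0$ find $\Gamma^{m+1}=\mathbf{X}^{m+1}=(x^{m+1},y^{m+1})^T\in\mathbb{X}^h$ and $\kappa^{m+1}\in\mathbb{K}^h$ such that $$\Bigl(\frac{\mathbf{X}^{m+1}-\mathbf{X}^m}{\tau}\cdot\mathbf{n}^m,\psi^h\Bigr)^h_{\Gamma^m}+\bigl(\partial_s\kappa^{m+1},\partial_s\psi^h\bigr)_{\Gamma^m}=0,\qquad\forall\,\psi^h\in\mathbb{K}^h,$$ $$\bigl(\kappa^{m+1},\mathbf{n}^m\cdot\boldsymbol{\omega}^h\bigr)^h_{\Gamma^m}-\bigl(\partial_s\mathbf{X}^{m+1},\partial_s\boldsymbol{\omega}^h\bigr)_{\Gamma^m}+\sigma\bigl[\omega^h_1(1)-\omega^h_1(0)\bigr]-\frac{1}{\eta\tau}\bigl[\omega^h_1(0)(x_l^{m+1}-x_l^m)+\omega^h_1(1)(x_r^{m+1}-x_r^m)\bigr]=0,\qquad\forall\,\boldsymbol{\omega}^h=(\omega^h_1,\omega^h_2)^T\in\mathbb{X}^h,$$ where $x_l^{m}=x^{m}(0)$ and $x_r^{m}=x^{m}(1)$ are assumed to satisfy $x_l^m\le x_r^m$. Assume that $\min_{1\le j\le N}|\mathbf{h}^m_j|>0$ for $m=1,2,\ldots$ and that, as $m\to+\infty$,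 $\mathbf{X}^m(\cdot)$ and $\kappa^m(\cdot)$ converge to an equilibrium $\Gamma^e=\mathbf{X}^e(\rho)=(x^e(\rho),y^e(\rho))^T\in\mathbb{X}^h$ and $\kappa^e(\rho)\in\mathbb{K}^h$, respectively, satisfying $\min_{1\le j\le N}|\mathbf{h}^e_j|>0$ with $\mathbf{h}^e_j:=\mathbf{X}^e(\rho_j)-\mathbf{X}^e(\rho_{j-1})$, $1\le j\le N$. Then $$\lim_{m\to+\infty}D^m=D^e:=\bigl(\partial_s\kappa^e,\partial_s\kappa^e\bigr)_{\Gamma^e}=0,\quad\text{and hence}\quad\kappa^e(\rho)\equiv\kappa^c,\ 0\le\rho\le1,$$ $$\lim_{m\to+\infty}\Psi^m=\Psi^e:=\frac{\max_{1\le j\le N}|\mathbf{h}^e_j|}{\min_{1\le j\le N}|\mathbf{h}^e_j|}=1,$$ where $\kappa^c\ne0$ is a constant. Furthermore, denoting by $\theta^l_e$ and $\theta^r_e$ the left and right contact angles of $\Gamma^e$, there exist $h_1>0$ sufficiently small and a constant $C_1>0$ such that $$|\cos(\theta^l_e)-\sigma|\le C_1h,\qquad|\cos(\theta^r_e)-\sigma|\le C_1h,\qquad 0<h\le h_1.$$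
   Context: $\mathbf{I}=[0,1]$; $\sigma\in(-1,1)$ and $\eta>0$ are constants; $\tau>0$ is the time step; $N\ge1$ is an integer, $h=1/N$ is the mesh size, $\rho_j=jh$ and $I_j=[\rho_{j-1},\rho_j]$. $\mathbb{K}^h$ is the space of continuous functions on $\mathbf{I}$ that are affine on each $I_j$; $\mathbb{K}^h_0=\{u\in\mathbb{K}^h:u(0)=u(1)=0\}$; $\mathbb{X}^h=\mathbb{K}^h\times\mathbb{K}^h_0$. In the last assertion $h$ varies, and the solution and its equilibrium depend on $h$. Write $\mathbf{h}^m_j=\mathbf{X}^m(\rho_j)-\mathbf{X}^m(\rho_{j-1})$ (also nonzero for $m=0$, so that the scheme is defined). On $I_j$ the unit tangent of $\Gamma^m$ is $\boldsymbol{\tau}^m_j=\mathbf{h}^m_j/|\mathbf{h}^m_j|$ and the unit normal is $\mathbf{n}^m_j=-(\boldsymbol{\tau}^m_j)^\perp$, where $(\cdot)^\perp$ is clockwise rotation by $90$ degrees (so $(a,b)^T\mapsto(b,-a)^T$); $\mathbf{n}^m$ is the piecewise constant function with value $\mathbf{n}^m_j$ on $I_j$. Inside $(\cdot,\cdot)_{\Gamma^m}$, on $I_j$, $\partial_s=\frac{h}{|\mathbf{h}^m_j|}\partial_\rho$ (derivative with respect to arc length of $\Gamma^m$), and analogously on $\Gamma^e$ with $\mathbf{h}^e_j$. $(u,v)_{\Gamma}$ is the $L^2$ inner product along the polygonal curve $\Gamma$ with respect to arc length, and the mass-lumped inner product is $$(u,v)^h_{\Gamma^m}=\frac12\sum_{j=1}^N|\mathbf{h}^m_j|\bigl[(u\cdot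 v)(\rho_j^-)+(u\cdot v)(\rho_{j-1}^+)\bigr],$$ with one-sided limits at the nodes. The mesh ratio indicator and curvature variation indicator are, for $m\ge1$, $$\Psi^m=\frac{\max_{1\le j\le N}|\mathbf{h}^m_j|}{\min_{1\le j\le N}|\mathbf{h}^m_j|},\qquad D^m=\bigl(\partial_s\kappa^m,\partial_s\kappa^m\bigr)_{\Gamma^{m-1}}.$$ The contact angles of $\Gamma^e$ are determined by $\cos\theta^l_e=\frac{\mathbf{h}^e_1}{|\mathbf{h}^e_1|}\cdot(1,0)^T$ and $\cos\theta^r_e=\frac{\mathbf{h}^e_N}{|\mathbf{h}^e_N|}\cdot(1,0)^T$.
   Formalization: The contact angle estimates are proved under the added assumption that the total absolute curvature of the equilibria (integral of |κ^e| along Γ^e) is bounded uniformly in h; without it, multiply wound equilibrium polygons violate the C_1 h bound. *)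

(* Defs.v *)
From HB Require Import structures.
From mathcomp Require Import all_boot all_order all_algebra.
From mathcomp Require Import all_classical all_reals all_analysis.

Set Implicit Arguments.
Unset Strict Implicit.
Unset Printing Implicit Defensive.

Import Order.TTheory GRing.Theory Num.Theory.
Import numFieldNormedType.Exports.

Local Open Scope classical_set_scope.
Local Open Scope ring_scope.

(* The plane is R * R. Its library norm is the max norm, so the Euclidean    *)
(* norm has a definition of its own.                                         *)
Definition dot (R : realType) (u v : R * R) : R := u.1 * v.1 + u.2 * v.2.

Definition enorm (R : realType) (u : R * R) : R := Num.sqrt (dot u u).

(* clockwise rotation by 90 degrees *)
Definition perp (R : realType) (u : R * R) : R * R := (u.2, - u.1).

Definition node (R : realType) (N j : nat) : R := j%:R / N%:R.

(* A function on [0, 1] is a total function whose values outside [0, 1] play *)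
(* no role.  Intervals are numbered from 0: number j < N is                  *)
(* [node N j, node N j.+1], so I_j is number j - 1.                          *)
Definition Kh (R : realType) (N : nat) (u : R -> R) : Prop :=
  {within `[0, 1], continuous u} /\
  forall j : nat, (j < N)%N -> exists a b : R,
    forall r : R, node R N j <= r <= node R N j.+1 -> u r = a + b * r.

Definition Kh0 (R : realType) (N : nat) (u : R -> R) : Prop :=
  [/\ Kh N u, u 0 = 0 & u 1 = 0].

Definition Xh (R : realType) (N : nat) (G : R -> R * R) : Prop :=
  Kh N (fun r => (G r).1) /\ Kh0 N (fun r => (G r).2).

Definition edge (R : realType) (N : nat) (G : R -> R * R) (j : nat) : R * R :=
  G (node R N j.+1) - G (node R N j).

Definition edge_length (R : realType) (N : nat) (G : R -> R * R) (j : nat) : R :=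
  enorm (edge N G j).

(* The value of edge number 0 starts both folds; it is one of the N values   *)
(* over which the maximum and the minimum are taken as soon as N >= 1.       *)
Definition max_edge (R : realType) (N : nat) (G : R -> R * R) : R :=
  \big[Num.max/edge_length N G 0]_(j < N) edge_length N G j.

Definition min_edge (R : realType) (N : nat) (G : R -> R * R) : R :=
  \big[Num.min/edge_length N G 0]_(j < N) edge_length N G j.

Definition mesh_ratio (R : realType) (N : nat) (G : R -> R * R) : R :=
  max_edge N G / min_edge N G.

Definition edge_tangent (R : realType) (N : nat) (G : R -> R * R) (j : nat) : R * R :=
  (edge_length N G j)^-1 *: edge N G j.

Definition edge_normal (R : realType) (N : nat) (G : R -> R * R) (j : nat) : R * R :=
  - perp (edge_tangent N G j).

(* number of the interval that contains r, for 0 <= r < 1 *)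
Definition interval_index (R : realType) (N : nat) (r : R) : nat :=
  Num.truncn (r * N%:R).

(* The piecewise constant normal.  Its values at the nodes are arbitrary:    *)
(* only its one-sided limits there are ever used.                            *)
Definition normal (R : realType) (N : nat) (G : R -> R * R) (r : R) : R * R :=
  edge_normal N G (interval_index N r).

Definition arc_deriv (R : realType) (N : nat) (G : R -> R * R) (u : R -> R) (r : R) : R :=
  N%:R^-1 / edge_length N G (interval_index N r) * derive1 u r.

Definition arc_deriv2 (R : realType) (N : nat) (G U : R -> R * R) (r : R) : R * R :=
  (arc_deriv N G (fun s => (U s).1) r, arc_deriv N G (fun s => (U s).2) r).

(* Integral along the polygon G with respect to arc length, ds being         *)
(* (|h_j| / h) d rho on each interval.  The L^2 inner product (u, v)_G is    *)
(* the integral of the (scalar or dot) product of u and v.                   *)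
Definition arc_integral (R : realType) (N : nat) (G : R -> R * R) (f : R -> R) : R :=
  \sum_(j < N) edge_length N G j / N%:R^-1 *
    (\int[@lebesgue_measure R]_(r in `]node R N j, node R N j.+1[) f r)%R.

(* Mass-lumped counterpart of arc_integral: (u, v)^h_G is the lumped         *)
(* integral of the product of u and v.                                       *)
Definition lumped_integral (R : realType) (N : nat) (G : R -> R * R) (f : R -> R) : R :=
  2^-1 * \sum_(j < N) edge_length N G j *
    (lim (f r @[r --> (node R N j.+1)^'-]) + lim (f r @[r --> (node R N j)^'+])).

(* One time step, from the curve G (= X^m) to the curve G' (= X^(m+1)) and   *)
(* the curvature k' (= kappa^(m+1)).                                         *)
Definition scheme_step (R : realType) (sigma eta tau : R) (N : nat)
    (G G' : R -> R * R) (k' : R -> R) : Prop :=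
  (forall psi : R -> R, Kh N psi ->
     lumped_integral N G
       (fun r => dot (tau^-1 *: (G' r - G r)) (normal N G r) * psi r)
     + arc_integral N G (fun r => arc_deriv N G k' r * arc_deriv N G psi r) = 0)
  /\
  (forall omega : R -> R * R, Xh N omega ->
     lumped_integral N G (fun r => k' r * dot (normal N G r) (omega r))
     - arc_integral N G
         (fun r => dot (arc_deriv2 N G G' r) (arc_deriv2 N G omega r))
     + sigma * ((omega 1).1 - (omega 0).1)
     - (eta * tau)^-1 * ((omega 0).1 * ((G' 0).1 - (G 0).1)
                         + (omega 1).1 * ((G' 1).1 - (G 1).1)) = 0).

(* kappa 0 is unconstrained: the scheme produces kappa^m for m >= 1 only. *)
Definition is_solution (R : realType) (sigma eta tau : R) (N : nat)
    (X : nat -> R -> R * R) (kappa : nat -> R -> R) : Prop :=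
  [/\ Xh N (X 0%N),
      (X 0%N 0).1 < (X 0%N 1).1 &
      forall m : nat,
        [/\ Xh N (X m.+1), Kh N (kappa m.+1) &
            scheme_step sigma eta tau N (X m) (X m.+1) (kappa m.+1)]].

(* (d_s k, d_s k)_G *)
Definition curvature_variation (R : realType) (N : nat) (G : R -> R * R) (k : R -> R) : R :=
  arc_integral N G (fun r => arc_deriv N G k r * arc_deriv N G k r).

Definition total_abs_curvature (R : realType) (N : nat) (G : R -> R * R) (k : R -> R) : R :=
  arc_integral N G (fun r => `|k r|).

Definition left_angle (R : realType) (N : nat) (G : R -> R * R) : R :=
  acos (dot (edge_tangent N G 0) (1, 0)).

Definition right_angle (R : realType) (N : nat) (G : R -> R * R) : R :=
  acos (dot (edge_tangent N G N.-1) (1, 0)).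

(* Main.v *)
Require Import Defs.
From HB Require Import structures.
From mathcomp Require Import all_boot all_order all_algebra.
From mathcomp Require Import all_classical all_reals all_analysis.
From mathcomp Require Import ring lra.

Set Implicit Arguments.
Unset Strict Implicit.
Unset Printing Implicit Defensive.

Import Order.TTheory GRing.Theory Num.Theory.
Import numFieldNormedType.Exports.

Local Open Scope classical_set_scope.
Local Open Scope ring_scope.

(** On functions that are affine on each mesh interval, both inner products of
    the scheme are finite sums over the edges that depend continuously on the
    nodal values as long as no edge vanishes ([stiffnessE], [lumped_normalE]).
    The scheme therefore passes to the limit, where the displacement X^(m+1) - X^m disappears: the first
    equation becomes (d_s k, d_s psi) = 0 for all psi ([equilibrium_flow]), the
    second a balance of forces without its time-dependent end term
    ([equilibrium_force]).

    Testing the first limit equation with psi = k gives a vanishing sum of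
    squares, so k is a constant c ([stiffness_eq0_const]).  With k = c, testing
    the second one with the hat function of an inner node between consecutive
    edges e and e', of lengths l and l', gives
      e / l - e' / l' = (c / 2) * (e + e') rotated by a quarter turn.
    The right-hand side is orthogonal to e + e', and the scalar product of the
    left-hand side with e + e' is (l - l') * (1 - cos a), a being the angle
    between e and e'.  So either l = l', or e and e' are parallel with the same
    direction, in which case e + e' is not zero and c = 0 ([equal_lengths]).

    The hat functions of the end nodes give the horizontal component of the
    first and last unit tangents as sigma up to (c / 2) times the height of the
    corresponding edge ([left_contact], [right_contact]).  If c were 0, all
    edges would have one direction, with horizontal component sigma; the two
    end points being at height 0, this direction would be horizontal, against
    |sigma| < 1 ([curvature_neq0]).  Finally, since the N edges have one length
    l, the total absolute curvature |c| * N * l controls |c| * l by a multiple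
    of 1 / N, hence the contact angles. *)

(** * Piecewise affine functions on the uniform mesh *)

Section Mesh.
Context {R : realType} {N : nat} (N_gt0 : (0 < N)%N).

Let NR_gt0 : 0 < N%:R :> R. Proof. by rewrite ltr0n. Qed.

Lemma node0 : node R N 0 = 0. Proof. by rewrite /node mul0r. Qed.

Lemma node_last : node R N N = 1.
Proof. by rewrite /node divff// gt_eqF. Qed.

Lemma node_itv j : (j <= N)%N -> 0 <= node R N j <= 1.
Proof.
by move=> jN; rewrite divr_ge0//= ler_pdivrMr// mul1r ler_nat.
Qed.

Lemma nodeS j : node R N j.+1 = node R N j + N%:R^-1.
Proof. by rewrite /node -addn1 natrD mulrDl div1r. Qed.

Lemma node_lt j : node R N j < node R N j.+1.
Proof. by rewrite nodeS ltrDl invr_gt0. Qed.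

Lemma interval_index_itv j (r : R) :
  node R N j < r < node R N j.+1 -> interval_index N r = j.
Proof.
move=> /andP[jr rj]; apply: truncn_def; apply/andP; split.
  by rewrite -ler_pdivrMr// ltW.
by rewrite -ltr_pdivlMr.
Qed.

Lemma Kh_affine (u : R -> R) j r : Kh N u -> (j < N)%N ->
  node R N j <= r <= node R N j.+1 ->
  u r = u (node R N j)
        + N%:R * (u (node R N j.+1) - u (node R N j)) * (r - node R N j).
Proof.
move=> [_ aff] /aff [a [b ab]] rj.
have jS := node_lt j.
rewrite !ab ?lexx ?(ltW jS)// nodeS.
by field; rewrite gt_eqF.
Qed.

Lemma derive1_Kh (u : R -> R) j r : Kh N u -> (j < N)%N ->
  node R N j < r < node R N j.+1 ->
  derive1 u r = N%:R * (u (node R N j.+1) - u (node R N j)).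
Proof.
move=> uK jN rj; rewrite derive1E.
set c := N%:R * _; set d := u (node R N j) - c * node R N j.
have -> : 'D_1 u r = 'D_1 (fun s => d + c * s) r.
  apply: near_eq_derive.
  have := @near_in_itvoo R (node R N j) (node R N j.+1) r.
  rewrite in_itv/= => /(_ rj); apply: filterS => s.
  rewrite in_itv/= => /andP[js sj].
  by rewrite (Kh_affine uK jN) ?(ltW js) ?(ltW sj)// -/c /d; ring.
have affine_derive := is_deriveD (is_derive_cst d r 1)
  (is_deriveM (is_derive_cst c r 1) (is_derive_id r (1:R))).
have -> : (fun s => d + c * s)
  = (cst d : R -> R) + (cst c : R -> R) * (id : R -> R) by [].
by rewrite derive_val /cst /= scaler0 add0r addr0 /GRing.scale/= mulr1.
Qed.

Lemma arc_deriv_Kh G (u : R -> R) j r : Kh N u -> (j < N)%N ->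
  node R N j < r < node R N j.+1 ->
  arc_deriv N G u r =
    (u (node R N j.+1) - u (node R N j)) / edge_length N G j.
Proof.
move=> uK jN rj.
rewrite /arc_deriv (interval_index_itv rj) (derive1_Kh uK jN rj).
by rewrite mulrACA mulVf ?gt_eqF// mul1r mulrC.
Qed.

(** On each interval the arc length factor l / h cancels the interval
    length h. *)
Lemma arc_integral_const G (f : R -> R) (c : nat -> R) :
  (forall j r, (j < N)%N -> node R N j < r < node R N j.+1 -> f r = c j) ->
  arc_integral N G f = \sum_(j < N) edge_length N G j * c j.
Proof.
move=> fc; apply: eq_bigr => j _.
have -> : (\int[@lebesgue_measure R]_(r in `]node R N j, node R N j.+1[) f r)%R
        = (\int[@lebesgue_measure R]_(r in `]node R N j, node R N j.+1[) (c j))%R.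
  apply: eq_Rintegral => r; rewrite inE/= in_itv/= => rj.
  by rewrite (fc j).
have len : lebesgue_measure `]node R N j, node R N j.+1[ = (N%:R^-1)%:E.
  by rewrite lebesgue_measure_itv/= lte_fin node_lt -EFinB nodeS addrAC subrr add0r.
rewrite Rintegral_cst//; rewrite [X in fine X](_ : _ = (N%:R^-1)%:E) /=.
  rewrite invrK -mulrA; congr (_ * _).
  by rewrite mulrCA divff ?mulr1// gt_eqF.
by rewrite -len.
Qed.

Lemma Kh_cvg_left (u : R -> R) j : Kh N u -> (j < N)%N ->
  u r @[r --> (node R N j.+1)^'-] --> u (node R N j.+1).
Proof.
move=> uK jN; have [a [b ab]] := uK.2 j jN.
have -> : u (node R N j.+1) = a + b * node R N j.+1.
  by rewrite ab// lexx ltW// node_lt.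
have aff : a + b * r @[r --> (node R N j.+1)^'-] --> a + b * node R N j.+1.
  apply: cvg_at_left_filter.
  by apply: cvgD; [exact: cvg_cst|apply: cvgM; [exact: cvg_cst|exact: cvg_id]].
apply: cvg_trans aff; apply: near_eq_cvg.
near=> r; apply/esym/ab; apply/andP; split; apply: ltW; near: r.
  exact: nbhs_left_gt (node_lt j).
exact: nbhs_left_lt.
Unshelve. all: by end_near. Qed.

Lemma Kh_cvg_right (u : R -> R) j : Kh N u -> (j < N)%N ->
  u r @[r --> (node R N j)^'+] --> u (node R N j).
Proof.
move=> uK jN; have [a [b ab]] := uK.2 j jN.
have -> : u (node R N j) = a + b * node R N j.
  by rewrite ab// lexx/= ltW// node_lt.
have aff : a + b * r @[r --> (node R N j)^'+] --> a + b * node R N j.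
  apply: cvg_at_right_filter.
  by apply: cvgD; [exact: cvg_cst|apply: cvgM; [exact: cvg_cst|exact: cvg_id]].
apply: cvg_trans aff; apply: near_eq_cvg.
near=> r; apply/esym/ab; apply/andP; split; apply: ltW; near: r.
  exact: nbhs_right_gt.
exact: nbhs_right_lt (node_lt j).
Unshelve. all: by end_near. Qed.

Lemma normal_cvg_left G j :
  normal N G r @[r --> (node R N j.+1)^'-] --> edge_normal N G j.
Proof.
apply: cvg_near_cst; near=> r; rewrite /normal (@interval_index_itv j)//.
apply/andP; split; near: r; last exact: nbhs_left_lt.
exact: nbhs_left_gt (node_lt j).
Unshelve. all: by end_near. Qed.

Lemma normal_cvg_right G j :
  normal N G r @[r --> (node R N j)^'+] --> edge_normal N G j.
Proof.
apply: cvg_near_cst; near=> r; rewrite /normal (@interval_index_itv j)//.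
apply/andP; split; near: r; first exact: nbhs_right_gt.
exact: nbhs_right_lt (node_lt j).
Unshelve. all: by end_near. Qed.

Lemma lumped_integral_cvg G (f : R -> R) (p q : nat -> R) :
  (forall j, (j < N)%N -> f r @[r --> (node R N j.+1)^'-] --> p j) ->
  (forall j, (j < N)%N -> f r @[r --> (node R N j)^'+] --> q j) ->
  lumped_integral N G f =
    2^-1 * \sum_(j < N) edge_length N G j * (p j + q j).
Proof.
move=> fp fq; congr (_ * _); apply: eq_bigr => j _; congr (_ * (_ + _)).
  by apply: cvg_lim; [exact: norm_hausdorff|exact: fp].
by apply: cvg_lim; [exact: norm_hausdorff|exact: fq].
Qed.

End Mesh.

(** * Limits of scalar products, sums and maxima *)

Section Pairs.
Context {R : realType} {T : Type} {F : set_system T} {FF : Filter F}.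

Lemma cvg_pair_fst (u : T -> R * R) (l : R * R) : u x @[x --> F] --> l ->
  (u x).1 @[x --> F] --> (l.1 : R).
Proof.
move=> ul; apply: (@cvg_comp _ _ _ u fst F (nbhs l) (nbhs l.1) ul).
by case: l {ul} => a b; exact: cvg_fst.
Qed.

Lemma cvg_pair_snd (u : T -> R * R) (l : R * R) : u x @[x --> F] --> l ->
  (u x).2 @[x --> F] --> (l.2 : R).
Proof.
move=> ul; apply: (@cvg_comp _ _ _ u snd F (nbhs l) (nbhs l.2) ul).
by case: l {ul} => a b; exact: cvg_snd.
Qed.

Lemma cvg_dot (u v : T -> R * R) (l m : R * R) :
  u x @[x --> F] --> l -> v x @[x --> F] --> m ->
  dot (u x) (v x) @[x --> F] --> dot l m.
Proof.
move=> ul vm; apply: cvgD; apply: cvgM;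
  by [exact: cvg_pair_fst|exact: cvg_pair_snd].
Qed.

Lemma cvg_perp (u : T -> R * R) (l : R * R) :
  u x @[x --> F] --> l -> perp (u x) @[x --> F] --> perp l.
Proof.
by move=> ul; exact: (cvg_pair (cvg_pair_snd ul) (cvgN (cvg_pair_fst ul))).
Qed.

End Pairs.

(** The initial value of the fold varies along the filter too: in [max_edge] and
    [min_edge] it is the length of the first edge. *)
Lemma cvg_fold (R : realType) (T : Type) (F : set_system T) (FF : Filter F)
    (op : R -> R -> R) (n : nat) (x : T -> R) (f : T -> nat -> R)
    (a : R) (b : nat -> R) :
  continuous (fun p : R * R => op p.1 p.2) ->
  x t @[t --> F] --> a ->
  (forall j, (j < n)%N -> f t j @[t --> F] --> b j) ->
  \big[op/x t]_(j < n) f t j @[t --> F] --> \big[op/a]_(j < n) b j.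
Proof.
move=> cop xa; elim: n f b => [|n IHn] f b fb.
  by rewrite big_ord0; under eq_fun do rewrite big_ord0.
rewrite big_ord_recl; under eq_fun do rewrite big_ord_recl.
have tl := IHn (fun t j => f t j.+1) (fun j => b j.+1) (fun j => fb j.+1).
apply: (@continuous2_cvg _ _ _ _ F _ _ _ op _ _ _ (fb 0%N (ltn0Sn n)) tl).
exact: cop (_, _).
Qed.

Lemma cvg_sum_ord (R : realType) (T : Type) (F : set_system T) (FF : Filter F)
    (n : nat) (f : 'I_n -> T -> R) (b : 'I_n -> R) :
  (forall j, f j t @[t --> F] --> b j) ->
  \sum_(j < n) f j t @[t --> F] --> \sum_(j < n) b j.
Proof.
by move=> fb; apply: cvg_big => [|j _]; [exact: add_continuous|exact: fb].
Qed.

(** * Interpolation of nodal values *)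

(** Rises from 0 to 1 across interval number j and is constant elsewhere. *)
Definition ramp (R : realType) (N j : nat) (r : R) : R :=
  Num.max 0 (Num.min 1 (N%:R * r - j%:R)).

Definition interpolant (R : realType) (N : nat) (w : nat -> R) (r : R) : R :=
  w 0%N + \sum_(j < N) (w j.+1 - w j) * ramp N j r.

Section Interpolation.
Context {R : realType} {N : nat} (N_gt0 : (0 < N)%N).

Let NR_gt0 : 0 < N%:R :> R. Proof. by rewrite ltr0n. Qed.

Lemma ramp_itv j k r : node R N k <= r <= node R N k.+1 ->
  ramp N j r = (if (j < k)%N then 1 else if j == k then - k%:R else 0)
             + (if j == k then N%:R else 0) * r.
Proof.
move=> /andP[kr rk].
have {}kr : k%:R <= N%:R * r by rewrite mulrC -ler_pdivrMr.
have {}rk : N%:R * r <= k%:R + 1 by rewrite mulrC -ler_pdivlMr// natr1.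
rewrite /ramp; case: ltngtP => [jk|kj|->].
- have : j.+1%:R <= k%:R :> R by rewrite ler_nat.
  by rewrite -natr1 => jk1; rewrite min_l ?max_r ?mul0r ?addr0//; lra.
- have : k.+1%:R <= j%:R :> R by rewrite ler_nat.
  rewrite -natr1 => jk1; rewrite min_r; last lra.
  by rewrite max_l ?mul0r ?addr0//; lra.
- by rewrite min_r ?max_r; lra.
Qed.

Lemma continuous_ramp j : continuous (@ramp R N j).
Proof.
move=> r; apply: (@continuous_max R R (cst 0)
  (fun s => Num.min 1 (N%:R * s - j%:R)) r);
  first exact: cvg_cst.
apply: (@continuous_min R R (cst 1) (fun s => N%:R * s - j%:R) r);
  first exact: cvg_cst.
apply: cvgB; last exact: cvg_cst.
by apply: cvgM; [exact: cvg_cst|exact: cvg_id].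
Qed.

(** On interval number k, [ramp_itv] makes every summand affine with
    coefficients independent of the point. *)
Lemma interpolant_Kh (w : nat -> R) : Kh N (interpolant N w).
Proof.
split.
  apply: continuous_subspaceT => r; apply: cvgD; first exact: cvg_cst.
  apply: cvg_big => [|j _]; first exact: add_continuous.
  by apply: cvgM; [exact: cvg_cst|exact: continuous_ramp].
move=> k kN.
exists (w 0%N + \sum_(j < N) (w j.+1 - w j)
   * (if (j < k)%N then 1 else if j == k :> nat then - k%:R else 0)).
exists (\sum_(j < N) (w j.+1 - w j) * (if j == k :> nat then N%:R else 0)).
move=> r rk; rewrite /interpolant -addrA mulr_suml -big_split/=.
by congr (_ + _); apply: eq_bigr => j _; rewrite (ramp_itv j rk) mulrDr mulrA.
Qed.

Lemma ramp_node j k : ramp N j (node R N k) = (j < k)%:R :> R.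
Proof.
have kk : node R N k <= node R N k <= node R N k.+1.
  by rewrite lexx ltW// node_lt.
rewrite (ramp_itv j kk) /node mulrCA; case: ltngtP => jk.
- by rewrite mul0r mulr0 addr0.
- by rewrite mul0r mulr0 addr0.
- by rewrite divff ?mulr1 ?addNr// gt_eqF.
Qed.

Lemma interpolant_node (w : nat -> R) k : (k <= N)%N ->
  interpolant N w (node R N k) = w k.
Proof.
move=> kN; rewrite /interpolant.
under eq_bigr do rewrite ramp_node mulr_natr mulrb.
rewrite -big_mkcond -(big_mkord (fun j => (j < k)%N) (fun j => w j.+1 - w j)).
rewrite (big_cat_nat (n := k))//= [X in _ + (_ + X)]big_nat_cond.
rewrite [X in _ + (_ + X)]big1 ?addr0; last first.
  by move=> j /andP[/andP[kj _]]; rewrite ltnNge kj.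
rewrite big_nat_cond (eq_bigl (fun j => (0 <= j < k)%N)); last first.
  by move=> j; rewrite leq0n/= andbb.
by rewrite -big_nat telescope_sumr// addrC subrK.
Qed.

Lemma interpolant0 (w : nat -> R) : interpolant N w 0 = w 0%N.
Proof. by rewrite -[X in interpolant N w X](@node0 R N) interpolant_node. Qed.

Lemma interpolant1 (w : nat -> R) : interpolant N w 1 = w N.
Proof.
by rewrite -[X in interpolant N w X](node_last N_gt0) interpolant_node.
Qed.

End Interpolation.

(** * The scheme in nodal values *)

(** The value of (d_s u, d_s v)_G on functions that are affine on each
    interval. *)
Definition stiffness (R : realType) (N : nat) (G : R -> R * R) (u v : R -> R) : R :=
  \sum_(j < N) (u (node R N j.+1) - u (node R N j))
    * (v (node R N j.+1) - v (node R N j)) / edge_length N G j.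

(** The mass-lumped product of W . n with u.  The length of edge number j
    cancels the normalization of its normal and leaves the rotated edge, a
    linear function of G. *)
Definition lumped_normal (R : realType) (N : nat) (G W : R -> R * R)
    (u : R -> R) : R :=
  2^-1 * \sum_(j < N)
    (dot (W (node R N j.+1)) (- perp (edge N G j)) * u (node R N j.+1)
     + dot (W (node R N j)) (- perp (edge N G j)) * u (node R N j)).

Section Discrete.
Context {R : realType} {N : nat} (N_gt0 : (0 < N)%N).

Lemma dot_edge_normal (G : R -> R * R) j (a : R * R) :
  edge_length N G j != 0 ->
  edge_length N G j * dot a (edge_normal N G j) = dot a (- perp (edge N G j)).
Proof.
rewrite /edge_normal /edge_tangent; set l := edge_length N G j => l0.
case: (edge N G j) => e1 e2; case: a => a1 a2.
rewrite /dot /perp/= /GRing.scale/=.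
by field.
Qed.

Lemma Kh2_cvg_left (G : R -> R * R) j :
  Kh N (fun r => (G r).1) -> Kh N (fun r => (G r).2) -> (j < N)%N ->
  G r @[r --> (node R N j.+1)^'-] --> G (node R N j.+1).
Proof.
move=> G1 G2 jN.
have -> : G = (fun r => ((G r).1, (G r).2)) by apply/funext => r; case: (G r).
exact: (cvg_pair (Kh_cvg_left N_gt0 G1 jN) (Kh_cvg_left N_gt0 G2 jN)).
Qed.

Lemma Kh2_cvg_right (G : R -> R * R) j :
  Kh N (fun r => (G r).1) -> Kh N (fun r => (G r).2) -> (j < N)%N ->
  G r @[r --> (node R N j)^'+] --> G (node R N j).
Proof.
move=> G1 G2 jN.
have -> : G = (fun r => ((G r).1, (G r).2)) by apply/funext => r; case: (G r).
exact: (cvg_pair (Kh_cvg_right N_gt0 G1 jN) (Kh_cvg_right N_gt0 G2 jN)).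
Qed.

Lemma stiffnessE (G : R -> R * R) (u v : R -> R) :
  Kh N u -> Kh N v -> (forall j, (j < N)%N -> edge_length N G j != 0) ->
  arc_integral N G (fun r => arc_deriv N G u r * arc_deriv N G v r) =
  stiffness N G u v.
Proof.
move=> uK vK l0.
rewrite (arc_integral_const N_gt0 G (c := fun j =>
  (u (node R N j.+1) - u (node R N j)) / edge_length N G j *
  ((v (node R N j.+1) - v (node R N j)) / edge_length N G j))).
  by apply: eq_bigr => j _; have := l0 j (ltn_ord j) => ?; field.
by move=> j r jN rj; rewrite !(arc_deriv_Kh N_gt0 _ _ jN rj).
Qed.

Lemma stiffness2E (G U V : R -> R * R) :
  Xh N U -> Xh N V -> (forall j, (j < N)%N -> edge_length N G j != 0) ->
  arc_integral N G (fun r => dot (arc_deriv2 N G U r) (arc_deriv2 N G V r)) =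
  stiffness N G (fun r => (U r).1) (fun r => (V r).1)
  + stiffness N G (fun r => (U r).2) (fun r => (V r).2).
Proof.
move=> [U1 [U2 _ _]] [V1 [V2 _ _]] l0.
rewrite (arc_integral_const N_gt0 G (c := fun j =>
  dot (edge N U j) (edge N V j) / edge_length N G j / edge_length N G j)).
  rewrite -big_split; apply: eq_bigr => j _ /=.
  by rewrite mulrC divfK ?l0// -mulrDl.
move=> j r jN rj; rewrite /dot /=.
rewrite (arc_deriv_Kh N_gt0 _ U1 jN rj) (arc_deriv_Kh N_gt0 _ U2 jN rj).
rewrite (arc_deriv_Kh N_gt0 _ V1 jN rj) (arc_deriv_Kh N_gt0 _ V2 jN rj).
by have := l0 _ jN => ?; field.
Qed.

Lemma lumped_normalE (G W : R -> R * R) (u : R -> R) :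
  Kh N (fun r => (W r).1) -> Kh N (fun r => (W r).2) -> Kh N u ->
  (forall j, (j < N)%N -> edge_length N G j != 0) ->
  lumped_integral N G (fun r => dot (W r) (normal N G r) * u r) =
  lumped_normal N G W u.
Proof.
move=> W1 W2 uK l0.
rewrite (@lumped_integral_cvg _ _ G _
  (fun j => dot (W (node R N j.+1)) (edge_normal N G j) * u (node R N j.+1))
  (fun j => dot (W (node R N j)) (edge_normal N G j) * u (node R N j))).
- congr (_ * _); apply: eq_bigr => j _.
  by rewrite mulrDr !mulrA !dot_edge_normal ?l0.
- move=> j jN; apply: cvgM; last exact: Kh_cvg_left.
  by apply: cvg_dot; [exact: Kh2_cvg_left|exact: normal_cvg_left].
- move=> j jN; apply: cvgM; last exact: Kh_cvg_right.
  by apply: cvg_dot; [exact: Kh2_cvg_right|exact: normal_cvg_right].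
Qed.

End Discrete.

Section Scheme.
Context {R : realType} {N : nat} (N_gt0 : (0 < N)%N).

Lemma KhZB (c : R) (u v : R -> R) : Kh N u -> Kh N v ->
  Kh N (fun r => c * (u r - v r)).
Proof.
move=> [cu au] [cv av]; split.
  move=> r; apply: cvgM; first exact: cvg_cst.
  by apply: cvgB; [exact: cu|exact: cv].
move=> j jN; have [a [b ab]] := au j jN; have [a' [b' ab']] := av j jN.
exists (c * (a - a')), (c * (b - b')) => r rj.
by rewrite ab// ab'//; ring.
Qed.

Lemma scheme_step_nodal (sigma eta tau : R) (G G' : R -> R * R) (k : R -> R) :
  Xh N G -> Xh N G' -> Kh N k ->
  (forall j, (j < N)%N -> edge_length N G j != 0) ->
  scheme_step sigma eta tau N G G' k ->
  (forall psi, Kh N psi ->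
    lumped_normal N G (fun r => tau^-1 *: (G' r - G r)) psi
    + stiffness N G k psi = 0) /\
  (forall omega, Xh N omega ->
    lumped_normal N G omega k
    - (stiffness N G (fun r => (G' r).1) (fun r => (omega r).1)
       + stiffness N G (fun r => (G' r).2) (fun r => (omega r).2))
    + sigma * ((omega 1).1 - (omega 0).1)
    - (eta * tau)^-1 * ((omega 0).1 * ((G' 0).1 - (G 0).1)
                        + (omega 1).1 * ((G' 1).1 - (G 1).1)) = 0).
Proof.
move=> [G1 [G2 _ _]] G'X kK l0 [flow force]; have [G'1 [G'2 _ _]] := G'X; split.
  move=> psi psiK; rewrite -(stiffnessE N_gt0)// -(lumped_normalE N_gt0)//.
  - exact: flow.
  - exact: KhZB.
  - exact: KhZB.
move=> omega omegaX; have [w1 [w2 _ _]] := omegaX.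
rewrite -(stiffness2E N_gt0)// -(lumped_normalE N_gt0)//.
rewrite [X in lumped_integral N G X](_ : _ =
  (fun r => k r * dot (normal N G r) (omega r))); first exact: force.
by apply/funext => r; rewrite /dot; ring.
Qed.

Lemma edge_length_gt0 (G : R -> R * R) j : 0 < min_edge N G -> (j < N)%N ->
  0 < edge_length N G j.
Proof.
move=> /lt_le_trans G0 jN; apply: G0.
exact: (bigmin_le (edge_length N G 0) (Ordinal jN)).
Qed.

(** * Passing to the limit *)

Section Limit.
Context {T : Type} {F : set_system T} {FF : Filter F}.
Context {Y : T -> R -> R * R} {Z : R -> R * R}.
Hypothesis YZ : forall r, 0 <= r <= 1 -> Y n r @[n --> F] --> Z r.

Lemma cvg_node j : (j <= N)%N -> Y n (node R N j) @[n --> F] --> Z (node R N j).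
Proof. by move=> jN; apply/YZ/node_itv. Qed.

Lemma cvg_edge j : (j < N)%N -> edge N (Y n) j @[n --> F] --> edge N Z j.
Proof. by move=> jN; apply: cvgB; apply: cvg_node => //; exact: ltnW. Qed.

Lemma cvg_edge_length j : (j < N)%N ->
  edge_length N (Y n) j @[n --> F] --> edge_length N Z j.
Proof.
move=> jN; have dotYZ : dot (edge N (Y n) j) (edge N (Y n) j) @[n --> F] -->
    dot (edge N Z j) (edge N Z j).
  by apply: cvg_dot; exact: cvg_edge.
exact: (@cvg_comp _ _ _ _ Num.sqrt F _ _ dotYZ (@sqrt_continuous R _)).
Qed.

Lemma cvg_mesh_ratio : min_edge N Z != 0 ->
  mesh_ratio N (Y n) @[n --> F] --> mesh_ratio N Z.
Proof.
have cvg_op (op : R -> R -> R) : continuous (fun p : R * R => op p.1 p.2) ->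
    \big[op/edge_length N (Y n) 0]_(j < N) edge_length N (Y n) j @[n --> F] -->
    \big[op/edge_length N Z 0]_(j < N) edge_length N Z j.
  move=> cop; apply: (@cvg_fold R T F _ op N (fun t => edge_length N (Y t) 0)
    (fun t j => edge_length N (Y t) j)) => // [|j jN]; exact: cvg_edge_length.
move=> Z0; apply: cvgM; last apply: cvgV => //.
  exact: (cvg_op Num.max max_continuous).
exact: (cvg_op Num.min min_continuous).
Qed.

Lemma cvg_stiffness (u v : T -> R -> R) (u' v' : R -> R) : 0 < min_edge N Z ->
  (forall r, 0 <= r <= 1 -> u t r @[t --> F] --> u' r) ->
  (forall r, 0 <= r <= 1 -> v t r @[t --> F] --> v' r) ->
  stiffness N (Y t) (u t) (v t) @[t --> F] --> stiffness N Z u' v'.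
Proof.
move=> Z0 uu' vv'; apply: cvg_sum_ord => j.
have jn : 0 <= node R N j <= 1 by apply: node_itv => //; exact: ltnW.
have jSn : 0 <= node R N j.+1 <= 1 by apply: node_itv.
apply: cvgM; last first.
  by apply: cvgV; [rewrite gt_eqF ?edge_length_gt0|exact: cvg_edge_length].
by apply: cvgM; apply: cvgB; first [exact: uu'|exact: vv'].
Qed.

Lemma cvg_lumped_normal (W : T -> R -> R * R) (u : T -> R -> R)
    (W' : R -> R * R) (u' : R -> R) :
  (forall r, 0 <= r <= 1 -> W t r @[t --> F] --> W' r) ->
  (forall r, 0 <= r <= 1 -> u t r @[t --> F] --> u' r) ->
  lumped_normal N (Y t) (W t) (u t) @[t --> F] --> lumped_normal N Z W' u'.
Proof.
move=> WW' uu'; apply: cvgM; first exact: cvg_cst.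
apply: cvg_sum_ord => j.
have cvg_normal : - perp (edge N (Y t) j) @[t --> F] --> - perp (edge N Z j).
  by apply: cvgN; apply: cvg_perp; exact: cvg_edge.
have jn : 0 <= node R N j <= 1 by apply: node_itv => //; exact: ltnW.
have jSn : 0 <= node R N j.+1 <= 1 by apply: node_itv.
apply: cvgD; apply: cvgM; try exact: uu'.
  exact: cvg_dot (WW' _ jSn) cvg_normal.
exact: cvg_dot (WW' _ jn) cvg_normal.
Qed.

End Limit.

End Scheme.

(** The limit of the second equation of the scheme. *)
Definition force_balance (R : realType) (sigma : R) (N : nat) (G : R -> R * R)
    (k : R -> R) : Prop :=
  forall omega, Xh N omega ->
  lumped_normal N G omega k
  - (stiffness N G (fun r => (G r).1) (fun r => (omega r).1)
     + stiffness N G (fun r => (G r).2) (fun r => (omega r).2))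
  + sigma * ((omega 1).1 - (omega 0).1) = 0.

Section Equilibrium.
Context {R : realType} {N : nat} (N_gt0 : (0 < N)%N).
Context {sigma eta tau : R} {X : nat -> R -> R * R} {kappa : nat -> R -> R}.
Context {Z : R -> R * R} {k : R -> R}.
Hypothesis sol : is_solution sigma eta tau N X kappa.
Hypothesis edgeX : forall m, 0 < min_edge N (X m).
Hypothesis edgeZ : 0 < min_edge N Z.
Hypothesis kK : Kh N k.
Hypothesis XZ : forall r, 0 <= r <= 1 -> X m r @[m --> \oo] --> Z r.
Hypothesis kappak : forall r, 0 <= r <= 1 -> kappa m r @[m --> \oo] --> k r.

Let XS r : 0 <= r <= 1 -> X m.+1 r @[m --> \oo] --> Z r.
Proof. by move=> /XZ; exact: (cvg_comp (addn 1) (X ^~ r) (@cvg_addnl 1)). Qed.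

Let kS r : 0 <= r <= 1 -> kappa m.+1 r @[m --> \oo] --> k r.
Proof.
by move=> /kappak; exact: (cvg_comp (addn 1) (kappa ^~ r) (@cvg_addnl 1)).
Qed.

Let X_Xh m : Xh N (X m).
Proof. by case: sol => X0 _ XSm; case: m => [//|m]; case: (XSm m). Qed.

(* The first curvature is arbitrary, hence the shift by one step. *)
Let kappa_Kh m : Kh N (kappa m.+1).
Proof. by case: sol => _ _ /(_ m)[]. Qed.

Let X0 m j (jN : (j < N)%N) : edge_length N (X m) j != 0.
Proof. by rewrite gt_eqF// edge_length_gt0. Qed.

Let nodal m := let: And3 _ _ step := sol in let: And3 _ _ stepm := step m in
  scheme_step_nodal N_gt0 (X_Xh m) (X_Xh m.+1) (kappa_Kh m) (@X0 m) stepm.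

Let Z0 j : (j < N)%N -> edge_length N Z j != 0.
Proof. by move=> jN; rewrite gt_eqF// edge_length_gt0. Qed.

Lemma cvg_curvature_variation :
  curvature_variation N (X m.-1) (kappa m) @[m --> \oo] -->
    curvature_variation N Z k.
Proof.
rewrite -(cvg_shiftS (fun m => curvature_variation N (X m.-1) (kappa m))).
rewrite /curvature_variation (stiffnessE N_gt0 kK kK Z0).
under eq_fun => m do
  rewrite (stiffnessE N_gt0 (kappa_Kh m) (kappa_Kh m) (@X0 m)).
exact: cvg_stiffness.
Qed.

(** The displacement between two steps tends to 0, so the lumped term of the
    first equation disappears in the limit. *)
Lemma equilibrium_flow psi : Kh N psi -> stiffness N Z k psi = 0.
Proof.
move=> psiK.
have stall r : 0 <= r <= 1 ->
    tau^-1 *: (X m.+1 r - X m r) @[m --> \oo] --> (0 : R * R).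
  move=> r01; rewrite -(scaler0 _ tau^-1) -(subrr (Z r)).
  by apply: cvgZr; apply: cvgB; [exact: XS|exact: XZ].
have step_limit : lumped_normal N (X m) (fun r => tau^-1 *: (X m.+1 r - X m r)) psi
    + stiffness N (X m) (kappa m.+1) psi @[m --> \oo] -->
    lumped_normal N Z (fun=> 0) psi + stiffness N Z k psi.
  apply: cvgD; first by apply: cvg_lumped_normal => // r _; exact: cvg_cst.
  by apply: cvg_stiffness => // r _; exact: cvg_cst.
move: step_limit; under eq_fun do rewrite (proj1 (nodal _) psi psiK).
move=> /(cvg_unique _ (cvg_cst 0)) ->//.
rewrite /lumped_normal big1 ?mulr0 ?add0r// => j _.
by rewrite /dot/= !mul0r addr0 !mul0r addr0.
Qed.

Lemma equilibrium_force : force_balance sigma N Z k.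
Proof.
move=> omega omegaX.
have end_stall r : 0 <= r <= 1 ->
    (omega r).1 * ((X m.+1 r).1 - (X m r).1) @[m --> \oo] --> 0.
  move=> r01; rewrite -(mulr0 (omega r).1) -(subrr (Z r).1).
  apply: cvgM; first exact: cvg_cst.
  by apply: cvgB; apply: cvg_pair_fst; [exact: XS|exact: XZ].
have step_limit : lumped_normal N (X m) omega (kappa m.+1)
    - (stiffness N (X m) (fun r => (X m.+1 r).1) (fun r => (omega r).1)
       + stiffness N (X m) (fun r => (X m.+1 r).2) (fun r => (omega r).2))
    + sigma * ((omega 1).1 - (omega 0).1)
    - (eta * tau)^-1 * ((omega 0).1 * ((X m.+1 0).1 - (X m 0).1)
                        + (omega 1).1 * ((X m.+1 1).1 - (X m 1).1)) @[m --> \oo] -->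
  lumped_normal N Z omega k
    - (stiffness N Z (fun r => (Z r).1) (fun r => (omega r).1)
       + stiffness N Z (fun r => (Z r).2) (fun r => (omega r).2))
    + sigma * ((omega 1).1 - (omega 0).1) - (eta * tau)^-1 * (0 + 0).
  apply: cvgB; last first.
    apply: cvgM; first exact: cvg_cst.
    by apply: cvgD; apply: end_stall; rewrite ?lexx ler01.
  apply: cvgD; last exact: cvg_cst.
  apply: cvgB; first by apply: cvg_lumped_normal => // r _; exact: cvg_cst.
  apply: cvgD; apply: cvg_stiffness => // r r01; try exact: cvg_cst.
    by apply: cvg_pair_fst; exact: XS.
  by apply: cvg_pair_snd; exact: XS.
move: step_limit; under eq_fun do rewrite (proj2 (nodal _) omega omegaX).
by move=> /(cvg_unique _ (cvg_cst 0)); rewrite addr0 mulr0 subr0 => <-.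
Qed.

End Equilibrium.

(** * Equilibria with constant curvature *)

(** Summing a nodal form against the hat function of node k leaves the two edges
    that meet there, or a single one if k is an end node. *)
Lemma sum_hat (R : realType) (N k : nat) (a b : nat -> R) :
  \sum_(j < N) (a j * (j.+1 == k)%:R + b j * (j == k :> nat)%:R) =
  (if k is i.+1 then (if (i < N)%N then a i else 0) else 0)
  + (if (k < N)%N then b k else 0).
Proof.
have pick (c : nat -> R) i :
    \sum_(j < N) c j * (j == i :> nat)%:R = if (i < N)%N then c i else 0.
  under eq_bigr do rewrite mulr_natr mulrb.
  by rewrite -big_mkcond big_ord1_eq.
rewrite big_split/= pick; congr (_ + _).
case: k => [|i]; last exact: pick.
by rewrite big1// => j _; rewrite mulr0.
Qed.

Section ConstantCurvature.
Context {R : realType} {N : nat} (N_gt0 : (0 < N)%N).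

(** The form is a sum of squares with positive weights 1 / l, so every increment
    of u vanishes. *)
Lemma stiffness_eq0_const (G : R -> R * R) (u : R -> R) :
  (forall j, (j < N)%N -> 0 < edge_length N G j) ->
  Kh N u -> stiffness N G u u = 0 -> forall r, 0 <= r <= 1 -> u r = u 0.
Proof.
move=> l0 uK /eqP; rewrite psumr_eq0; last first.
  by move=> j _; rewrite -expr2 divr_ge0 ?sqr_ge0 ?ltW ?l0.
move=> /allP flat.
have step j : (j < N)%N -> u (node R N j.+1) = u (node R N j).
  move=> jN; have := flat (Ordinal jN) (mem_index_enum _).
  rewrite mulf_eq0 invr_eq0 (gt_eqF (l0 j jN)) orbF mulf_eq0 orbb subr_eq0.
  by move=> /eqP.
have nodes j : (j <= N)%N -> u (node R N j) = u 0.
  by elim: j => [|j IH] jN; [rewrite node0|rewrite step ?IH// ltnW].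
move=> r /andP[r0]; rewrite le_eqVlt => /predU1P[->|r1].
  by rewrite -(node_last N_gt0) nodes.
have NR0 : 0 < N%:R :> R by rewrite ltr0n.
have /truncn_itv/andP[jr rj] : 0 <= r * N%:R by rewrite mulr_ge0// ltW.
have jN : (Num.truncn (r * N%:R) < N)%N.
  by rewrite -(ltr_nat R); apply: le_lt_trans jr _; rewrite gtr_pMl//.
rewrite (Kh_affine N_gt0 (r := r) uK jN); last first.
  by rewrite ler_pdivrMr// jr/= ler_pdivlMr// ltW.
by rewrite step// subrr mulr0 mul0r addr0 nodes// ltnW.
Qed.

Lemma edge_sqr (G : R -> R * R) j :
  (edge N G j).1 ^+ 2 + (edge N G j).2 ^+ 2 = edge_length N G j ^+ 2.
Proof. by rewrite sqr_sqrtr ?addr_ge0 ?sqr_ge0// /dot !expr2. Qed.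

Section ForceBalance.
Context {sigma c : R} {Z : R -> R * R} {k : R -> R}.
Hypothesis k_cst : forall r, 0 <= r <= 1 -> k r = c.
Hypothesis ZX : Xh N Z.
Hypothesis edgeZ : forall j, (j < N)%N -> 0 < edge_length N Z j.
Hypothesis force : force_balance sigma N Z k.

Let e := edge N Z.
Let l := edge_length N Z.
(* Contribution of edge number j to the force on its end node and on its start
   node: the lumped curvature, and the tension of the edge. *)
Let hor_end j := - (c / 2) * (e j).2 - (e j).1 / l j.
Let hor_start j := - (c / 2) * (e j).2 + (e j).1 / l j.
Let ver_end j := c / 2 * (e j).1 - (e j).2 / l j.
Let ver_start j := c / 2 * (e j).1 + (e j).2 / l j.

Let k_node j : (j <= N)%N -> k (node R N j) = c.
Proof. by move=> jN; apply/k_cst/node_itv. Qed.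

Let zero_Kh : Kh N (fun=> 0 : R).
Proof.
split; first by apply: continuous_subspaceT => r; exact: cvg_cst.
by move=> j _; exists 0, 0 => r _; rewrite mul0r addr0.
Qed.

Lemma horizontal_force (w : nat -> R) :
  \sum_(j < N) (hor_end j * w j.+1 + hor_start j * w j)
  + sigma * (w N - w 0%N) = 0.
Proof.
have wX : Xh N (fun r => (interpolant N w r, 0)).
  by split=> //=; exact: interpolant_Kh.
have := force wX.
have w0 := interpolant0 N_gt0 w; have w1 := interpolant1 N_gt0 w.
rewrite /= w0 w1 => force0; rewrite -[RHS]force0; congr (_ + _).
rewrite [X in _ - (_ + X)]big1; last by move=> j _; rewrite subrr mulr0 mul0r.
rewrite addr0 /lumped_normal /stiffness mulr_sumr -sumrB; apply: eq_bigr => j _.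
have jN := ltn_ord j.
rewrite !interpolant_node ?k_node ?(ltnW jN)// /dot/=.
rewrite /hor_end /hor_start /ver_end /ver_start -/l /e /edge/=.
by field; rewrite gt_eqF// edgeZ.
Qed.

Lemma vertical_force (w : nat -> R) : w 0%N = 0 -> w N = 0 ->
  \sum_(j < N) (ver_end j * w j.+1 + ver_start j * w j) = 0.
Proof.
move=> w00 wN0.
have w0 := interpolant0 N_gt0 w; have w1 := interpolant1 N_gt0 w.
have wX : Xh N (fun r => (0, interpolant N w r)).
  by split=> //=; split; [exact: interpolant_Kh|rewrite w0|rewrite w1].
have := force wX.
rewrite /= subrr mulr0 addr0 => force0; rewrite -[RHS]force0.
rewrite [X in _ - (X + _)]big1; last by move=> j _; rewrite subrr mulr0 mul0r.
rewrite add0r /lumped_normal /stiffness mulr_sumr -sumrB; apply: eq_bigr => j _.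
have jN := ltn_ord j.
rewrite !interpolant_node ?k_node ?(ltnW jN)// /dot/=.
rewrite /hor_end /hor_start /ver_end /ver_start -/l /e /edge/=.
by field; rewrite gt_eqF// edgeZ.
Qed.

(** The hat function of the first node meets a single edge, and its value at
    the end point brings in sigma. *)
Lemma left_contact : (e 0).1 / l 0 - sigma = c / 2 * (e 0).2.
Proof.
have := horizontal_force (fun j => (j == 0)%:R).
rewrite (sum_hat N 0 hor_end hor_start) /hor_end /hor_start.
by rewrite N_gt0 (gtn_eqF N_gt0)/=; lra.
Qed.

Lemma right_contact : (e N.-1).1 / l N.-1 - sigma = - (c / 2) * (e N.-1).2.
Proof.
have := horizontal_force (fun j => (j == N)%:R).
rewrite (sum_hat N N hor_end hor_start) /hor_end /hor_start.
rewrite ltnn eqxx (ltn_eqF N_gt0).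
by case: (N) N_gt0 => // M _; rewrite ltnSn/=; lra.
Qed.

Lemma horizontal_balance j : (j.+1 < N)%N ->
  (e j).1 / l j - (e j.+1).1 / l j.+1 = - (c / 2) * ((e j).2 + (e j.+1).2).
Proof.
move=> jN; have := horizontal_force (fun i => (i == j.+1)%:R).
rewrite (sum_hat N j.+1 hor_end hor_start) /hor_end /hor_start.
by rewrite jN (ltnW jN) (gtn_eqF jN)/=; lra.
Qed.

Lemma vertical_balance j : (j.+1 < N)%N ->
  (e j).2 / l j - (e j.+1).2 / l j.+1 = c / 2 * ((e j).1 + (e j.+1).1).
Proof.
move=> jN; have := @vertical_force (fun i => (i == j.+1)%:R) erefl.
rewrite (gtn_eqF jN) => /(_ erefl).
rewrite (sum_hat N j.+1 ver_end ver_start) /ver_end /ver_start.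
by rewrite jN (ltnW jN)/=; lra.
Qed.

(** Without curvature all the unit tangents agree; the horizontal component is
    then sigma by [left_contact], and the vertical one is 0 because the end
    points have the same height. *)
Lemma curvature_neq0 : -1 < sigma < 1 -> c != 0.
Proof.
move=> sigma1; apply/eqP => c0.
have t1 j : (j < N)%N -> (e j).1 / l j = sigma.
  elim: j => [|j IH] jN.
    by apply/eqP; rewrite -subr_eq0 left_contact c0 !mul0r.
  apply/eqP; rewrite -(IH (ltnW jN)) -subr_eq0 -oppr_eq0 opprB.
  by rewrite horizontal_balance// c0 mul0r oppr0 mul0r.
have t2 j : (j < N)%N -> (e j).2 / l j = (e 0).2 / l 0.
  elim: j => [//|j IH] jN.
  apply/eqP; rewrite -(IH (ltnW jN)) -subr_eq0 -oppr_eq0 opprB.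
  by rewrite vertical_balance// c0 !mul0r.
have closed : \sum_(j < N) (e j).2 = 0.
  rewrite -(big_mkord xpredT (fun j => (e j).2)) telescope_sumr//.
  have [_ [_ y0 y1]] := ZX.
  by rewrite node_last// node0 y0 y1 subrr.
have : (e 0).2 / l 0 * \sum_(j < N) l j = 0.
  rewrite mulr_sumr -[RHS]closed; apply: eq_bigr => j _.
  by rewrite -(t2 j)// divfK// gt_eqF// edgeZ.
have len : 0 < \sum_(j < N) l j.
  rewrite (bigD1 (Ordinal N_gt0))//= ltr_pwDl ?edgeZ// sumr_ge0// => j _.
  by rewrite ltW ?edgeZ.
move=> /eqP; rewrite mulf_eq0 (gt_eqF len) orbF => /eqP t20.
have := edge_sqr Z 0; rewrite -/e -/l => e0.
have l0 : l 0 != 0 by rewrite gt_eqF// edgeZ.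
have : ((e 0).1 / l 0) ^+ 2 + ((e 0).2 / l 0) ^+ 2 = 1.
  by rewrite !expr_div_n -mulrDl e0 divff// expf_neq0.
by rewrite t1// t20; move: sigma1 => /andP[? ?]; nra.
Qed.

(** With unit tangents t and t', the curvature force is orthogonal to
    e + e' = l t + l' t', which leaves (l - l') * (1 - t . t') = 0.  If
    t . t' = 1, then t = t' and the balance reads c * (l + l') * t = 0 up to a
    rotation. *)
Lemma equal_lengths j : c != 0 -> (j.+1 < N)%N -> l j.+1 = l j.
Proof.
move=> c0 jN.
have := horizontal_balance jN; have := vertical_balance jN.
have := edge_sqr Z j; have := edge_sqr Z j.+1; rewrite -/e -/l.
have := edgeZ jN; have := edgeZ (ltnW jN); rewrite -/l.
move: (e j) (e j.+1) (l j) (l j.+1) => [p q] [p' q'] m m' /= m0 m'0.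
(* a, b and a', b' are the coordinates of the unit tangents. *)
set a := p / m; set b := q / m; set a' := p' / m'; set b' := q' / m'.
have -> : p = m * a by rewrite mulrC divfK// gt_eqF.
have -> : q = m * b by rewrite mulrC divfK// gt_eqF.
have -> : p' = m' * a' by rewrite mulrC divfK// gt_eqF.
have -> : q' = m' * b' by rewrite mulrC divfK// gt_eqF.
move: a b a' b' => {p q p' q'} a b a' b'.
rewrite !exprMn -!mulrDr => u' u ver hor.
have ab : a ^+ 2 + b ^+ 2 = 1.
  by apply: (mulfI (x := m ^+ 2)); rewrite ?mulr1// expf_neq0// gt_eqF.
have ab' : a' ^+ 2 + b' ^+ 2 = 1.
  by apply: (mulfI (x := m' ^+ 2)); rewrite ?mulr1// expf_neq0// gt_eqF.
have ortho : (m - m') * (1 - (a * a' + b * b')) = 0.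
  transitivity ((a - a') * (m * a + m' * a') + (b - b') * (m * b + m' * b')).
    transitivity (m * (a ^+ 2 + b ^+ 2) - m' * (a' ^+ 2 + b' ^+ 2)
                  + (m' - m) * (a * a' + b * b')); last by ring.
    by rewrite ab ab'; ring.
  by rewrite ver hor; ring.
move/eqP: ortho; rewrite mulf_eq0 subr_eq0 => /orP[/eqP//|/eqP par].
have : (a - a') ^+ 2 + (b - b') ^+ 2 == 0 by apply/eqP; nra.
rewrite paddr_eq0 ?sqr_ge0// !sqrf_eq0 !subr_eq0 => /andP[/eqP aa /eqP bb].
move: ver hor; rewrite -aa -bb !subrr -!mulrDl => /esym/eqP + /esym/eqP.
rewrite !mulf_eq0 oppr_eq0 mulf_eq0 (negPf c0) invr_eq0 pnatr_eq0/=.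
rewrite (gt_eqF (addr_gt0 m0 m'0))/= => /eqP a0 /eqP b0.
by move: ab; rewrite a0 b0 expr0n addr0 => /esym/eqP; rewrite oner_eq0.
Qed.

End ForceBalance.

Lemma mesh_ratio_eq1 (G : R -> R * R) : 0 < edge_length N G 0 ->
  (forall j, (j.+1 < N)%N -> edge_length N G j.+1 = edge_length N G j) ->
  mesh_ratio N G = 1.
Proof.
move=> l0 eql.
have {}eql j : (j < N)%N -> edge_length N G j = edge_length N G 0.
  by elim: j => // j IH jN; rewrite eql// IH// ltnW.
have fold (op : R -> R -> R) : (forall x, op x x = x) ->
    \big[op/edge_length N G 0]_(j < N) edge_length N G j = edge_length N G 0.
  move=> opxx; under eq_bigr => j _ do rewrite eql//.
  by elim/big_ind: _ => // x y -> ->.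
rewrite /mesh_ratio /max_edge /min_edge fold ?fold ?divff ?gt_eqF//.
  exact: minxx.
exact: maxxx.
Qed.

End ConstantCurvature.

(** * Contact angles *)

Section Angles.
Context {R : realType} {N : nat} (N_gt0 : (0 < N)%N).

Lemma edge_width_le (G : R -> R * R) j :
  `|(edge N G j).1| <= edge_length N G j.
Proof.
rewrite -(ler_pXn2r (n := 2)) ?nnegrE ?sqrtr_ge0//.
by rewrite -edge_sqr real_normK ?num_real// lerDl sqr_ge0.
Qed.

Lemma edge_height_le (G : R -> R * R) j :
  `|(edge N G j).2| <= edge_length N G j.
Proof.
rewrite -(ler_pXn2r (n := 2)) ?nnegrE ?sqrtr_ge0//.
by rewrite -edge_sqr real_normK ?num_real// lerDr sqr_ge0.
Qed.

Lemma cos_acos_tangent (G : R -> R * R) j : 0 < edge_length N G j ->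
  cos (acos (dot (edge_tangent N G j) (1, 0)))
  = (edge N G j).1 / edge_length N G j.
Proof.
move=> l0; have wide := edge_width_le G j; move: wide.
rewrite /dot /edge_tangent /= mulr1 mulr0 addr0 /GRing.scale/= mulrC => wide.
rewrite acosK// in_itv/= -ler_norml normrM normfV (gtr0_norm l0).
by rewrite ler_pdivrMr// mul1r.
Qed.

Lemma total_abs_curvature_const (G : R -> R * R) (k : R -> R) (c : R) :
  (forall r, 0 <= r <= 1 -> k r = c) ->
  total_abs_curvature N G k = `|c| * \sum_(j < N) edge_length N G j.
Proof.
move=> kc; rewrite /total_abs_curvature.
rewrite (arc_integral_const N_gt0 G (c := fun=> `|c|)).
  by rewrite -mulr_suml mulrC.
move=> j r jN /andP[jr rj]; rewrite kc//.
have /andP[j0 _] := @node_itv R N N_gt0 j (ltnW jN).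
have /andP[_ j1] := @node_itv R N N_gt0 j.+1 jN.
by rewrite (le_trans j0 (ltW jr)) (le_trans (ltW rj) j1).
Qed.

End Angles.

(** The contact angle errors are given by edge heights, hence bounded by |k 0|
    times the common length of the edges, for which the first edge stands. *)
Lemma equilibrium_properties (R : realType) (sigma eta tau : R) (N : nat)
    (X : nat -> R -> R * R) (kappa : nat -> R -> R)
    (Z : R -> R * R) (k : R -> R) :
  (0 < N)%N -> -1 < sigma < 1 -> is_solution sigma eta tau N X kappa ->
  (forall m, 0 < min_edge N (X m)) -> Xh N Z -> Kh N k ->
  (forall r, 0 <= r <= 1 -> X m r @[m --> \oo] --> Z r) ->
  (forall r, 0 <= r <= 1 -> kappa m r @[m --> \oo] --> k r) ->
  0 < min_edge N Z ->
  [/\ curvature_variation N Z k = 0,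
      k 0 != 0,
      forall r, 0 <= r <= 1 -> k r = k 0,
      forall j, (j < N)%N -> edge_length N Z j = edge_length N Z 0 &
      cos (left_angle N Z) - sigma = k 0 / 2 * (edge N Z 0).2 /\
      cos (right_angle N Z) - sigma = - (k 0 / 2) * (edge N Z N.-1).2].
Proof.
move=> N0 sigma1 sol Xgt0 ZX kK XZ kappak Zgt0.
have l0 j (jN : (j < N)%N) : 0 < edge_length N Z j by exact: edge_length_gt0.
have flow := equilibrium_flow N0 sol Xgt0 Zgt0 XZ kappak kK.
have k_cst := stiffness_eq0_const N0 l0 kK flow.
have force := equilibrium_force N0 sol Xgt0 Zgt0 XZ kappak.
have k0 := curvature_neq0 N0 k_cst ZX l0 force sigma1.
split=> //.
- by rewrite /curvature_variation (stiffnessE N0)// => j jN; rewrite gt_eqF// l0.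
- elim=> // j IH jN; rewrite -(IH (ltnW jN)).
  exact: (equal_lengths N0 k_cst l0 force k0 jN).
- rewrite /left_angle /right_angle !cos_acos_tangent ?l0 ?ltn_predL//.
    split; first exact: (left_contact N0 k_cst l0 force).
  exact: (right_contact N0 k_cst l0 force).
Qed.

Theorem proposition4p1 (R : realType) (sigma eta tau : R) (meshes : set nat)
    (X : nat -> nat -> R -> R * R) (kappa : nat -> nat -> R -> R)
    (Xe : nat -> R -> R * R) (kappae : nat -> R -> R)
    (sigma_bd : -1 < sigma < 1) (eta_gt0 : 0 < eta) (tau_gt0 : 0 < tau)
    (N_ge1 : forall N, meshes N -> (1 <= N)%N)
    (solX : forall N, meshes N -> is_solution sigma eta tau N (X N) (kappa N))
    (ordered : forall N, meshes N -> forall m : nat, (X N m 0).1 <= (X N m 1).1)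
    (edges_gt0 : forall N, meshes N -> forall m : nat, 0 < min_edge N (X N m))
    (Xe_space : forall N, meshes N -> Xh N (Xe N))
    (kappae_space : forall N, meshes N -> Kh N (kappae N))
    (cvgX : forall N, meshes N -> forall r : R, 0 <= r <= 1 ->
       X N m r @[m --> \oo] --> Xe N r)
    (cvgkappa : forall N, meshes N -> forall r : R, 0 <= r <= 1 ->
       kappa N m r @[m --> \oo] --> kappae N r)
    (edgese_gt0 : forall N, meshes N -> 0 < min_edge N (Xe N)) :
  (forall N, meshes N ->
     [/\ curvature_variation N (X N m.-1) (kappa N m) @[m --> \oo]
           --> curvature_variation N (Xe N) (kappae N),
         curvature_variation N (Xe N) (kappae N) = 0,
         exists2 kappac : R, kappac != 0 &
           forall r : R, 0 <= r <= 1 -> kappae N r = kappac,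
         mesh_ratio N (X N m) @[m --> \oo] --> mesh_ratio N (Xe N) &
         mesh_ratio N (Xe N) = 1]) /\
  ((exists K : R, forall N, meshes N ->
      total_abs_curvature N (Xe N) (kappae N) <= K) ->
   exists h1 C1 : R, [/\ 0 < h1, 0 < C1 &
     forall N, meshes N -> N%:R^-1 <= h1 ->
       `|cos (left_angle N (Xe N)) - sigma| <= C1 * N%:R^-1 /\
       `|cos (right_angle N (Xe N)) - sigma| <= C1 * N%:R^-1]).
Proof.
have eqP N (hN : meshes N) := equilibrium_properties (N_ge1 N hN) sigma_bd
  (solX N hN) (edges_gt0 N hN) (Xe_space N hN) (kappae_space N hN)
  (cvgX N hN) (cvgkappa N hN) (edgese_gt0 N hN).
split=> [N hN|[K boundK]].
  have [D0 k0 k_cst eql _] := eqP N hN; split=> //.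
  - exact: (cvg_curvature_variation (N_ge1 N hN) (solX N hN) (edges_gt0 N hN)
      (edgese_gt0 N hN) (kappae_space N hN) (cvgX N hN) (cvgkappa N hN)).
  - by exists (kappae N 0).
  - apply: (cvg_mesh_ratio (N_ge1 N hN)); first exact: cvgX.
    by rewrite gt_eqF// edgese_gt0.
  - apply: mesh_ratio_eq1 => [|j jN]; last by rewrite !eql// ltnW.
    by apply: edge_length_gt0; [exact: edgese_gt0|exact: N_ge1].
exists 1, (`|K| + 1); split=> [//||N hN _]; first by rewrite ltr_wpDl.
have [_ _ k_cst eql [-> ->]] := eqP N hN; have N0 := N_ge1 N hN.
have NR0 : 0 < N%:R :> R by rewrite ltr0n.
have short j (jN : (j < N)%N) :
    `|kappae N 0 / 2 * (edge N (Xe N) j).2| <= (`|K| + 1) * N%:R^-1.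
  (* All N edges have the length of the first one, so the total absolute
     curvature is N * |c| * l. *)
  have bound : `|kappae N 0| * edge_length N (Xe N) 0 <= `|K| / N%:R.
    rewrite ler_pdivlMr// -mulrA; apply: le_trans (ler_norm K).
    apply: le_trans (boundK N hN).
    rewrite (total_abs_curvature_const N0 _ k_cst).
    rewrite (eq_bigr (fun=> edge_length N (Xe N) 0)) => [|i _]; last exact: eql.
    by rewrite sumr_const card_ord mulr_natr.
  have := edge_height_le (N := N) (Xe N) j; rewrite eql// => height.
  rewrite !normrM (ger0_norm (x := 2^-1)) ?invr_ge0//.
  have := ler_wpM2l (normr_ge0 (kappae N 0)) height.
  have : 0 <= `|kappae N 0| * `|(edge N (Xe N) j).2| by rewrite mulr_ge0.
  have : 0 < (N%:R : R)^-1 by rewrite invr_gt0.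
  by move: bound; lra.
by split; [exact: short|rewrite mulNr normrN short// ltn_predL].
Qed.
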